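(* Let $I$ be a monomial ideal in a polynomial ring $R$ in finitely many variables over a field. Let $\{x_i,y_i\}_{i=1}^{\ell}$ be a set of (pairwise) disjoint leaf pairs with respect to $I$. Then $x_1+y_1, \ldots, x_{\ell}+y_{\ell}$ is both a regular sequence and an initially regular sequence on $R/I$ with respect to any term order such that $x_i > y_i$ for all $i$.
   Context: A variable $x$ is a leaf in a monomial ideal $I$ if there is a unique minimal monomial generator $M$ of $I$ with $x \mid M$. An ordered pair of (distinct) leaves $x,y$ of $I$, with $M_1, M_2$ the unique minimal monomial generators of $I$ such that $x \mid M_1$ and $y \mid M_2$, is a leaf pair if $M_1\neq M_2$ and there exist monomials $z,w\in R$ such that $x\nmid z$, $z\mid M_1$, $y\nmid w$, $w\mid M_2$, $\gcd(z,w)=1$ and $zw\in I$. Two leaf pairs $x,y$ and $a,b$ are disjoint if $\{x,y\}\cap\{a,b\}=\emptyset$. $\mathfrak m$ is the ideal of $R$ generated by all the variables. A term order is a monomial order (a total order on monomials, compatible with multiplication, with $1$ smallest), and $\mathrm{in}(J)$ is the initial ideal of $J$ with respect to the fixed term order. An element $f\in\mathfrak m$ is regular on $R/J$ if it is a non-zerodivisor on $R/J$. A sequence $f_1,\dots,f_q\in\mathfrak m$ is a regular sequence on $R/I$ if $f_i$ is regular on $R/(I,f_1,\dots,f_{i-1})$ for each $i$. It is an initially regular sequence on $R/I$ (with respect to a fixed term order; $f_i$ nonconstant) if for each $i=1,\dots,q$, $f_i$ is regular on $R/I_i$, where $I_1=\mathrm{in}(I)$ and $I_i=\mathrm{in}\big((I_{i-1},f_{i-1})\big)$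 for $i\ge 2$. *)

(* Defs.v *)
From mathcomp Require Import all_boot all_order all_algebra.
From mathcomp Require Export mpoly.

Set Implicit Arguments.
Unset Strict Implicit.
Unset Printing Implicit Defensive.

Import GRing.Theory.
Local Open Scope ring_scope.

Section Ideals.
Variables (K : fieldType) (n : nat).
Local Notation R := {mpoly K[n]}.
(* Ideals are Prop-valued subsets of R, since membership in an arbitrary ideal
   is not decidable; equality of ideals is pointwise equivalence. Monomials are
   exponent vectors m : 'X_{1..n}, so divisibility is (_ <= _)%MM. *)
Implicit Types (S J : R -> Prop) (f p : R) (fs : seq R).
Implicit Types (m M : 'X_{1..n}) (G : 'X_{1..n} -> Prop).

Definition ideal_gen S p : Prop :=
  exists (k : nat) (a g : 'I_k -> R),
    (forall i, S (g i)) /\ p = \sum_(i < k) a i * g i.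

Definition monomials G p : Prop := exists2 m, G m & p = 'X_[m].

Definition monomial_generators J G : Prop :=
  forall p, J p <-> ideal_gen (monomials G) p.

Definition monomial_ideal J : Prop := exists G, monomial_generators J G.

Definition minimal_monomial_generators J G : Prop :=
  monomial_generators J G /\
  forall G', (forall m, G' m -> G m) -> monomial_generators J G' ->
    forall m, G m -> G' m.

Definition minimal_generator J M : Prop :=
  exists2 G, minimal_monomial_generators J G & G M.

Definition max_ideal : R -> Prop := ideal_gen (fun p => exists i, p = 'X_i).

(* The ideal (J, fs). *)
Definition adjoin J fs : R -> Prop := ideal_gen (fun p => J p \/ p \in fs).

(* f p = 0 in R/J implies p = 0 in R/J. *)
Definition regular_on J f : Prop :=
  max_ideal f /\ forall p, J (f * p) -> J p.

Definition regular_sequence J fs : Prop :=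
  forall i, (i < size fs)%N -> regular_on (adjoin J (take i fs)) fs`_i.

(* mle m1 m2 means m1 <= m2. *)
Definition term_order (mle : rel 'X_{1..n}) : Prop :=
  [/\ total mle, antisymmetric mle, transitive mle,
      forall m m1 m2, mle m1 m2 -> mle (m + m1)%MM (m + m2)%MM
    & forall m, mle 0%MM m].

Definition mlt (mle : rel 'X_{1..n}) m1 m2 : bool := mle m1 m2 && (m1 != m2).

Definition leading_monomial (mle : rel 'X_{1..n}) f m : Prop :=
  m \in msupp f /\ forall m', m' \in msupp f -> mle m' m.

(* As K is a field, leading coefficients are irrelevant here. The zero
   polynomial has empty support, hence no leading monomial. *)
Definition initial_ideal (mle : rel 'X_{1..n}) J : R -> Prop :=
  ideal_gen (monomials (fun m => exists2 f, J f & leading_monomial mle f m)).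

(* 0-based: the i-th ideal is the one on which fs`_i is to be regular. *)
Fixpoint initial_chain (mle : rel 'X_{1..n}) J fs (i : nat) : R -> Prop :=
  if i is j.+1 then
    initial_ideal mle (adjoin (initial_chain mle J fs j) [:: fs`_j])
  else initial_ideal mle J.

Definition initially_regular_sequence (mle : rel 'X_{1..n}) J fs : Prop :=
  forall i, (i < size fs)%N ->
    (forall c : K, fs`_i != c%:MP) /\
    regular_on (initial_chain mle J fs i) fs`_i.

Definition leaf_generator J (x : 'I_n) M : Prop :=
  unique (fun M => minimal_generator J M /\ (U_(x) <= M)%MM) M.

Definition leaf J (x : 'I_n) : Prop := exists M, leaf_generator J x M.

Definition mgcd m1 m2 : 'X_{1..n} := [multinom minn (m1 i) (m2 i) | i < n].

Definition leaf_pair J (x y : 'I_n) : Prop :=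
  [/\ x <> y, leaf J x, leaf J y &
    exists M1 M2, [/\ leaf_generator J x M1, leaf_generator J y M2, M1 <> M2 &
      exists z w : 'X_{1..n},
        [/\ ~~ (U_(x) <= z)%MM /\ (z <= M1)%MM,
            ~~ (U_(y) <= w)%MM /\ (w <= M2)%MM,
            mgcd z w = 0%MM & J 'X_[(z + w)%MM]]]].

Definition disjoint_pairs (x y a b : 'I_n) : Prop :=
  [set x; y] :&: [set a; b] = set0.

End Ideals.

(* Main.v *)
(** Passing to the quotient by [x + y], i.e. substituting [-y] for [x], sends a
    monomial ideal to a monomial ideal: its monomials are merged, the exponent
    of [x] being moved to [y]. So both the initial ideals of the chain and, up
    to the isomorphism given by the substitutions [x_i -> - y_i], the quotients
    by [x_1 + y_1, ..., x_k + y_k] are again monomial, and [x + y] is regular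
    modulo a monomial ideal as soon as [x m] and [y m] in the ideal force [m]
    in it. That implication holds for a leaf pair with generators [A] and [B]:
    some minimal generator [M] divides [z w], hence [lcm(A, B)], and [M]
    contains no leaf variable at all, so it survives the merging of the other
    pairs; and if [A | x m] and [B | y m] then [M | m], as [M] involves neither
    [x] nor [y]. *)
Require Import Defs.
From mathcomp Require Import all_boot all_order all_algebra.
From mathcomp Require Import mpoly.
From Stdlib Require Import Classical.
From mathcomp Require Import zify.

Set Implicit Arguments.
Unset Strict Implicit.
Unset Printing Implicit Defensive.

Import GRing.Theory.
Local Open Scope ring_scope.

(** * Closure properties of generated ideals *)

Section GeneratedIdeals.
Variables (K : fieldType) (n : nat).
Local Notation R := {mpoly K[n]}.
Implicit Types (S J : R -> Prop) (a f g p q : R) (fs : seq R).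

Lemma ideal_gen_ind S (P : R -> Prop) :
  P 0 -> (forall p q, P p -> P q -> P (p + q)) ->
  (forall a g, S g -> P (a * g)) ->
  forall p, ideal_gen S p -> P p.
Proof.
move=> P0 PD PM p [k [a [g [Sg ->]]]].
by apply: (big_ind P) => // i _; apply: PM.
Qed.

Lemma ideal_gen0 S : ideal_gen S 0.
Proof.
by exists 0%N, (fun=> 0), (fun=> 0); split=> [[]|] //; rewrite big_ord0.
Qed.

Lemma ideal_genD S p q : ideal_gen S p -> ideal_gen S q -> ideal_gen S (p + q).
Proof.
move=> [k1 [a1 [g1 [S1 ->]]]] [k2 [a2 [g2 [S2 ->]]]].
exists (k1 + k2)%N.
exists (fun i => match split i with inl j => a1 j | inr j => a2 j end).
exists (fun i => match split i with inl j => g1 j | inr j => g2 j end).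
split=> [i|]; first by case: (split i).
rewrite big_split_ord /=; congr (_ + _); apply: eq_bigr => i _.
  by rewrite (unsplitK (inl i)).
by rewrite (unsplitK (inr i)).
Qed.

Lemma ideal_genM S a p : ideal_gen S p -> ideal_gen S (a * p).
Proof.
move=> [k [b [g [Sg ->]]]]; exists k, (fun i => a * b i), g; split=> //.
by rewrite mulr_sumr; apply: eq_bigr => i _; rewrite mulrA.
Qed.

Lemma ideal_gen_mem S g : S g -> ideal_gen S g.
Proof.
move=> Sg; exists 1%N, (fun=> 1), (fun=> g); split=> //.
by rewrite big_ord1 mul1r.
Qed.

Lemma ideal_gen_sum S (T : eqType) (r : seq T) (F : T -> R) :
  (forall t, t \in r -> ideal_gen S (F t)) -> ideal_gen S (\sum_(t <- r) F t).
Proof.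
move=> SF; rewrite big_seq; apply: (big_ind (ideal_gen S)) => //.
- exact: ideal_gen0.
- exact: ideal_genD.
Qed.

Lemma ideal_gen_sub S S' p :
  (forall g, S g -> ideal_gen S' g) -> ideal_gen S p -> ideal_gen S' p.
Proof.
move=> SS'; apply: ideal_gen_ind.
- exact: ideal_gen0.
- exact: ideal_genD.
- by move=> a g /SS'; apply: ideal_genM.
Qed.

Lemma adjoin_sub J fs fs' p :
  {subset fs <= fs'} -> adjoin J fs p -> adjoin J fs' p.
Proof.
move=> sub; apply: ideal_gen_sub => g [Jg|/sub fs_g]; apply: ideal_gen_mem.
  by left.
by right.
Qed.

End GeneratedIdeals.

(** * Monomial ideals as up-closed sets of monomials *)

Section MonomialIdeals.
Variables (K : fieldType) (n : nat).
Local Notation R := {mpoly K[n]}.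
Implicit Types (J : R -> Prop) (f g p : R).
Implicit Types (S G : 'X_{1..n} -> Prop) (m M N : 'X_{1..n}) (a b x y z : 'I_n).

Definition up_closed S : Prop := forall m m', S m -> S (m + m')%MM.

Definition supported S p : Prop := forall m, m \in msupp p -> S m.

Lemma up_closed_le S m m' : up_closed S -> (m <= m')%MM -> S m -> S m'.
Proof. by move=> upS /submK <- Sm; rewrite addmC; apply: upS. Qed.

Lemma supported0 S : supported S 0.
Proof. by move=> m; rewrite mcoeff_msupp mcoeff0 eqxx. Qed.

Lemma supportedD S p q : supported S p -> supported S q -> supported S (p + q).
Proof.
by move=> Sp Sq m /msuppD_le; rewrite mem_cat => /orP[/Sp|/Sq].
Qed.

Lemma supportedM S p q : up_closed S -> supported S q -> supported S (p * q).
Proof.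
move=> upS Sq m /msuppM_le /allpairsP [[m1 m2] /= [_ /Sq Sm2 ->]].
by rewrite addmC; apply: upS.
Qed.

Lemma supportedX S m : supported S 'X_[m] <-> S m.
Proof.
split=> [|Sm m']; first by apply; rewrite msuppX inE.
by rewrite msuppX inE => /eqP ->.
Qed.

Lemma supported_sub S S' p :
  (forall m, S m -> S' m) -> supported S p -> supported S' p.
Proof. by move=> SS' Sp m /Sp /SS'. Qed.

(** Divisibility by a generator is an up-closed condition, so it survives multiplication by any
    polynomial; conversely [p] is expanded into its monomials. *)
Lemma ideal_gen_monomials G p :
  ideal_gen (monomials G) p <->
  supported (fun m => exists2 N, G N & (N <= m)%MM) p.
Proof.
split.
  apply: (@ideal_gen_ind _ _ _ (supported _)); [exact: supported0 | exact: supportedD |].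
  move=> a _ [N GN ->]; apply: supportedM.
    by move=> m m' [N' GN' le]; exists N' => //; apply: lepm_trans le (lem_addr _ _).
  by apply/supportedX; exists N => //; apply: lepm_refl.
move=> Gp; rewrite [p]mpolyE; apply: ideal_gen_sum => m /Gp [N GN le].
rewrite -mul_mpolyC -(submK le) mpolyXD; do 2 apply: ideal_genM.
by apply: ideal_gen_mem; exists N.
Qed.

Definition monomials_in J m : Prop := J 'X_[m].

Lemma monomial_ideal_supported J :
  monomial_ideal J ->
  up_closed (monomials_in J) /\ forall p, J p <-> supported (monomials_in J) p.
Proof.
move=> [G JG].
have JX m : monomials_in J m <-> exists2 N, G N & (N <= m)%MM.
  by rewrite /monomials_in JG ideal_gen_monomials supportedX.
split.
  move=> m m' /JX [N GN le]; apply/JX; exists N => //.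
  exact: lepm_trans le (lem_addr _ _).
move=> p; rewrite JG ideal_gen_monomials.
by split; apply: supported_sub => m /JX.
Qed.

Lemma mdeg_lt m m' : (m <= m')%MM -> m <> m' -> (mdeg m < mdeg m')%N.
Proof.
move=> le neq.
rewrite -[m' in X in (_ < X)%N](submK le) mdegD.
rewrite -[X in (X < _)%N]add0n ltn_add2r lt0n mdeg_eq0; apply/eqP => e.
by apply: neq; rewrite -(submK le) e addmC addm0.
Qed.

(** [minimal_generator] asks for a whole minimal generating set; the monomials of [J] that are
    minimal for divisibility provide one. *)
Lemma minimal_generator_dvd J m :
  monomial_ideal J -> J 'X_[m] ->
  exists N, [/\ minimal_generator J N, J 'X_[N] & (N <= m)%MM].
Proof.
move=> monJ; have [upJ JE] := monomial_ideal_supported monJ.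
pose P N := J 'X_[N] /\ forall m', J 'X_[m'] -> (m' <= N)%MM -> m' = N.
(* Descent on the degree: a monomial of [J] that is not minimal has a proper divisor in [J]. *)
have P_dvd k m1 : (mdeg m1 <= k)%N -> J 'X_[m1] -> exists2 N, P N & (N <= m1)%MM.
  elim: k m1 => [|k IHk] m1 le_k Jm1.
    exists m1; last exact: lepm_refl.
    split=> // m' Jm' le; apply: NNPP => /(mdeg_lt le) lt.
    by have := leq_trans lt le_k.
  have [[m' [Jm' le neq]]|noM] :=
      classic (exists m', [/\ J 'X_[m'], (m' <= m1)%MM & m' <> m1]).
    have [|N PN leN] := IHk m' _ Jm'; last by exists N => //; apply: lepm_trans leN le.
    by rewrite -ltnS; apply: leq_trans (mdeg_lt le neq) le_k.
  exists m1; last exact: lepm_refl.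
  by split=> // m' Jm' le; apply: NNPP => neq; apply: noM; exists m'.
have PG : minimal_monomial_generators J P.
  have genP : monomial_generators J P.
    move=> p; rewrite ideal_gen_monomials JE; split; apply: supported_sub => m'.
      exact: (P_dvd _ _ (leqnn _)).
    by move=> [N [JN _] le]; apply: up_closed_le le JN.
  split=> // G' subG' genG' N PN; case: (PN) => JN minN.
  (* A generating subset contains a divisor of [N], which is [N] itself by minimality. *)
  have [N' GN' le] : exists2 N', G' N' & (N' <= N)%MM.
    by have := JN; rewrite genG' ideal_gen_monomials supportedX.
  by rewrite -(minN N') //; case: (subG' _ GN').
move=> /(P_dvd _ _ (leqnn _)) [N PN le].
by exists N; split=> //; [exists P | case: PN].
Qed.

(** * Cancelling x + y modulo a monomial ideal *)

Lemma mcoeff_addXM x y f m :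
  (('X_x + 'X_y) * f)@_(U_(y) + m) =
  f@_m + (if (U_(x) <= U_(y) + m)%MM then f@_(U_(y) + m - U_(x)) else 0).
Proof.
rewrite mulrDl mcoeffD addrC; congr (_ + _); rewrite mulrC.
  by rewrite mcoeffMX.
case: ifP => le; first by rewrite -{1}(submK le) [(_ - _ + _)%MM]addmC mcoeffMX.
apply/eqP; rewrite mcoeff_eq0; apply/negP => /msuppM_le /allpairsP.
move=> [[m1 m2] /= []]; rewrite msuppX inE => _ /eqP -> e.
by rewrite e lem_addl in le.
Qed.

(** The coefficient of (x + y) f at y m comes from m and from y m / x. If the latter is not in the
    support of [f], nothing cancels and y m is in [S]; otherwise recurse on y m / x, where the
    exponent of x is smaller. *)
Lemma supported_addXM x y S f m :
  x != y -> up_closed S -> supported S (('X_x + 'X_y) * f) ->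
  m \in msupp f -> exists k, S (m + U_(y) *+ k)%MM.
Proof.
move=> neq upS Sf; move: {2}(m x) (erefl (m x)) => a.
elim: a m => [|a IHa] m mx fm.
  exists 1%N; rewrite mulm1n addmC; apply: Sf.
  rewrite mcoeff_msupp mcoeff_addXM lep1mP mnmDE mnm1E mx addn0.
  by rewrite [y == x]eq_sym (negPf neq) /= addr0 -mcoeff_msupp.
have [fm'|nfm'] := boolP ((U_(y) + m - U_(x))%MM \in msupp f).
  have [|k Sk] := IHa _ _ fm'.
    by rewrite mnmBE mnmDE !mnm1E eqxx [y == x]eq_sym (negPf neq) mx add0n subn1.
  exists k.+1; apply: (up_closed_le upS _ Sk).
  apply/mnm_lepP => v; rewrite !(mnmDE, mnmBE, mulmnE, mnm1E); lia.
exists 1%N; rewrite mulm1n addmC; apply: Sf.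
rewrite mcoeff_msupp mcoeff_addXM.
move: nfm'; rewrite -mcoeff_eq0 => /eqP ->.
by rewrite if_same addr0 -mcoeff_msupp.
Qed.

(** For an up-closed [S], this says that the colon of its ideal by (x, y) is the ideal itself. *)
Definition jointly_cancellable S x y : Prop :=
  forall m, S (U_(x) + m)%MM -> S (U_(y) + m)%MM -> S m.

(** By [supported_addXM], used in both orders, [S] contains some m y^k and some m x^l. Joint
    cancellation reduces m to x m and y m, each of which lowers one of the two exponents, so
    induction on k + l concludes. *)
Lemma addX_cancel x y S f :
  x != y -> up_closed S -> jointly_cancellable S x y ->
  supported S (('X_x + 'X_y) * f) -> supported S f.
Proof.
move=> neq upS canS Sf m fm.
have [k Sk] := supported_addXM neq upS Sf fm.
have [l Sl] : exists l, S (m + U_(x) *+ l)%MM.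
  by rewrite addrC in Sf; apply: supported_addXM Sf fm; rewrite 1?eq_sym.
move: {2}(k + l)%N (leqnn (k + l)) => d.
elim: d k l m {fm} Sk Sl => [|d IHd] k l m Sk Sl le_d.
  by move: Sk; rewrite (_ : k = 0)%N ?mulm0n ?addm0 //; lia.
case: k Sk le_d => [|k] Sk le_d; first by rewrite mulm0n addm0 in Sk.
case: l Sl le_d => [|l] Sl le_d; first by rewrite mulm0n addm0 in Sl.
apply: canS.
  apply: (IHd k.+1 l); last by lia.
    by rewrite -addmA addmC; apply: upS.
  by move: Sl; rewrite mulmS addmA [(_ + m)%MM]addmC.
apply: (IHd k l.+1); last by lia.
  by move: Sk; rewrite mulmS addmA [(_ + m)%MM]addmC.
by rewrite -addmA addmC; apply: upS.
Qed.


(** * Merging one variable into another, and the cancellation criterion it preserves *)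

Definition merge x y m : 'X_{1..n} :=
  [multinom if v == x then 0%N else (m v + (v == y) * m x)%N | v < n].

Lemma mergeE x y m v :
  merge x y m v = if v == x then 0%N else (m v + (v == y) * m x)%N.
Proof. exact: mnmE. Qed.

Lemma merge_id x y m : m x = 0%N -> merge x y m = m.
Proof.
move=> mx; apply/mnmP => v; rewrite mergeE.
by case: eqP => [->|_]; rewrite mx ?muln0 ?addn0.
Qed.

(** With a common part u free of x, a monomial and its merge become u x^a and u y^a, a form suited
    both to congruences modulo x + y and to term orders. *)
Lemma merge_split x y m :
  x != y -> exists u : 'X_{1..n},
    [/\ u x = 0%N, m = (u + U_(x) *+ m x)%MM
      & merge x y m = (u + U_(y) *+ m x)%MM].
Proof.
move=> neq; exists [multinom if v == x then 0%N else m v | v < n].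
split; first by rewrite mnmE eqxx.
  apply/mnmP => v; rewrite mnmDE mulmnE mnmE mnm1E eq_sym.
  by case: eqP => [->|_]; rewrite ?mul1n ?mul0n ?add0n ?addn0.
apply/mnmP => v; rewrite mergeE mnmDE mulmnE mnmE mnm1E [v == y]eq_sym.
by case: (v =P x) => [->|//]; rewrite eq_sym (negPf neq).
Qed.

Lemma mergeDU x y z m :
  z != x -> (merge x y (U_(z) + m) = U_(z) + merge x y m)%MM.
Proof.
move=> neq; apply/mnmP => v; rewrite !(mergeE, mnmDE, mnm1E) (negPf neq).
by case: (v =P x) => [->|_]; rewrite ?(negPf neq) ?add0n ?addnA.
Qed.

Lemma merge_le x y m m' : (m <= m')%MM -> (merge x y m <= merge x y m')%MM.
Proof.
move=> /mnm_lepP le; apply/mnm_lepP => v; rewrite !mergeE; case: ifP => // _.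
by rewrite leq_add // leq_mul.
Qed.

(** The ring is not shrunk: x remains a free variable, and the merged monomials generate an ideal of
    the whole ring. *)
Definition collapse x y S m : Prop :=
  exists2 N, S N & (merge x y N <= m)%MM.

(** Passing to the initial ideal also adds x, the leading monomial of x + y when x > y. *)
Definition add_var x S m : Prop := S m \/ (U_(x) <= m)%MM.

Lemma up_closed_collapse x y S : up_closed (collapse x y S).
Proof.
by move=> m m' [N SN le]; exists N => //; apply: lepm_trans le (lem_addr _ _).
Qed.

Lemma up_closed_add_var x S : up_closed S -> up_closed (add_var x S).
Proof.
move=> upS m m' [Sm|le]; first by left; apply: upS.
by right; apply: lepm_trans le (lem_addr _ _).
Qed.

(** [A] and [B] stand for the generators containing the two leaves. Their uniqueness is kept only in
    the weak form of the last two clauses, which merging preserves. *)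
Definition lcm_witness S x y M : Prop :=
  [/\ S M, M x = 0%N, M y = 0%N & exists A B : 'X_{1..n},
    [/\ forall v, (M v <= maxn (A v) (B v))%N,
        forall m, S (U_(x) + m)%MM -> S m \/ (A <= U_(x) + m)%MM &
        forall m, S (U_(y) + m)%MM -> S m \/ (B <= U_(y) + m)%MM]].

Lemma lcm_witness_cancel S x y M :
  up_closed S -> lcm_witness S x y M -> jointly_cancellable S x y.
Proof.
move=> upS [SM Mx My [A [B [MAB SA SB]]]] m /SA [//|/mnm_lepP leA].
move=> /SB [//|/mnm_lepP leB]; apply: up_closed_le SM => //.
apply/mnm_lepP => v; have := MAB v; have := leA v; have := leB v.
rewrite !mnmDE !mnm1E.
case: (x =P v) => [<-|_]; first by rewrite Mx.
case: (y =P v) => [<-|_]; first by rewrite My.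
rewrite !add0n => leBv leAv /leq_trans; apply.
by rewrite geq_max leAv.
Qed.

(* If merge(N) divides z m, then either z divides N and N / z serves for m, or
   merge(N) already divides m. *)
Lemma collapse_peel S a b z A :
  a != z -> b != z -> up_closed S ->
  (forall m, S (U_(z) + m)%MM -> S m \/ (A <= U_(z) + m)%MM) ->
  forall m, collapse a b S (U_(z) + m)%MM ->
    collapse a b S m \/ (merge a b A <= U_(z) + m)%MM.
Proof.
move=> az bz upS SA m [N SN leN].
have [Nz|Nz] := boolP (U_(z) <= N)%MM; last first.
  left; exists N => //; apply/mnm_lepP => v; move/mnm_lepP/(_ v): leN.
  rewrite lep1mP negbK in Nz; rewrite mnmDE mnm1E.
  case: (z =P v) => [<-|//]; rewrite mergeE (eqP Nz) ![z == _]eq_sym.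
  by rewrite (negPf az) (negPf bz).
move: SN leN; rewrite -(submK Nz) addmC mergeDU 1?eq_sym //.
set N' := (N - U_(z))%MM => SN leN.
have [SN'|/(merge_le a b) leA] := SA _ SN.
  left; exists N' => //; apply/mnm_lepP => v; move/mnm_lepP/(_ v): leN.
  by rewrite !mnmDE leq_add2l.
by right; apply: lepm_trans leA _; rewrite mergeDU 1?eq_sym.
Qed.

(** Merging fixes [M], which is free of a and b, and alters [A] and [B] only at a and b, where the
    exponents of [M] vanish. *)
Lemma lcm_witness_collapse S x y M a b :
  a != x -> a != y -> b != x -> b != y -> M a = 0%N -> M b = 0%N ->
  up_closed S -> lcm_witness S x y M -> lcm_witness (collapse a b S) x y M.
Proof.
move=> ax ay bx by_ Ma Mb upS [SM Mx My [A [B [MAB SA SB]]]].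
split=> //; first by exists M; rewrite // merge_id // lepm_refl.
exists (merge a b A), (merge a b B); split; [|exact: collapse_peel..].
move=> v; rewrite !mergeE; case: (v =P a) => [->|_]; first by rewrite Ma.
case: (v =P b) => [->|_]; first by rewrite Mb.
by rewrite !mul0n !addn0.
Qed.

(** As a differs from x and y, it divides x m or y m only if it divides m. *)
Lemma lcm_witness_add_var S x y M a :
  a != x -> a != y -> lcm_witness S x y M -> lcm_witness (add_var a S) x y M.
Proof.
move=> ax ay [SM Mx My [A [B [MAB SA SB]]]].
have addV z C : a != z -> (forall m, S (U_(z) + m)%MM -> S m \/ (C <= U_(z) + m)%MM) ->
    forall m, add_var a S (U_(z) + m)%MM -> add_var a S m \/ (C <= U_(z) + m)%MM.
  move=> az SC m [/SC [Sm|le]|]; [by left; left | by right |].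
  rewrite !lep1mP mnmDE mnm1E [z == a]eq_sym (negPf az) => ma.
  by left; right; rewrite lep1mP.
split=> //; first by left.
by exists A, B; split=> //; apply: addV.
Qed.

(** * The witness supplied by a leaf pair *)

Lemma leaf_pair_witness J x y :
  monomial_ideal J -> leaf_pair J x y ->
  exists2 M, lcm_witness (monomials_in J) x y M & forall v, leaf J v -> M v = 0%N.
Proof.
move=> monJ [_ _ _ [A [B [[[gA xA] uA] [[gB yB] uB] AB [z [w]]]]]].
move=> [[xz zA] [yw wB] zw Jzw].
have [upJ _] := monomial_ideal_supported monJ.
have [M [gM JM leM]] := minimal_generator_dvd monJ Jzw.
have leMv v : (M v <= z v + w v)%N by rewrite -mnmDE; apply/mnm_lepP.
have zAv v : (z v <= A v)%N by apply/mnm_lepP.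
have wBv v : (w v <= B v)%N by apply/mnm_lepP.
(* Each leaf lies in one generator only and [A] differs from [B]; so x divides neither z nor w, and
   neither does y. *)
have Bx : B x = 0%N.
  apply/eqP/negPn/negP; rewrite -lep1mP => xB.
  by apply: AB; apply: uA.
have Ay : A y = 0%N.
  apply/eqP/negPn/negP; rewrite -lep1mP => yA.
  by apply: AB; symmetry; apply: uB.
have zx : z x = 0%N by apply/eqP; rewrite lep1mP negbK in xz.
have wy : w y = 0%N by apply/eqP; rewrite lep1mP negbK in yw.
have Mx : M x = 0%N by have := leMv x; have := wBv x; lia.
have My : M y = 0%N by have := leMv y; have := zAv y; lia.
exists M; last first.
  (* A leaf dividing [M] would divide z or w, hence [A] or [B]; uniqueness would make that generator
     equal to [M], although it contains x or y and [M] contains neither. *)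
  move=> v [L [[gL vL] uL]]; apply/eqP/negPn/negP => Mv.
  have LM : L = M by apply: uL; rewrite lep1mP.
  have [Av|Bv] : A v != 0%N \/ B v != 0%N.
  - by have := leMv v; have := zAv v; have := wBv v; move: Mv; lia.
  - have LA : L = A by apply: uL; rewrite lep1mP.
    by move: xA; rewrite -LA LM lep1mP Mx.
  - have LB : L = B by apply: uL; rewrite lep1mP.
    by move: yB; rewrite -LB LM lep1mP My.
(* A minimal generator dividing v m either contains v, and is then [C], or already divides m. *)
have peel v C : (forall M', minimal_generator J M' /\ (U_(v) <= M')%MM -> C = M') ->
    forall m, monomials_in J (U_(v) + m)%MM ->
      monomials_in J m \/ (C <= U_(v) + m)%MM.
  move=> uC m Jm; have [N [gN JN leN]] := minimal_generator_dvd monJ Jm.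
  have [vN|] := boolP (U_(v) <= N)%MM; first by right; rewrite (uC N).
  rewrite lep1mP negbK => /eqP vN; left; apply: up_closed_le JN => //.
  apply/mnm_lepP => u; move/mnm_lepP/(_ u): leN; rewrite mnmDE mnm1E.
  by case: (v =P u) => [<-|//]; rewrite vN.
split=> //; exists A, B; split; [|exact: peel..].
(* As z and w are coprime, their product is their lcm, which divides the lcm of [A] and [B]. *)
move=> v; have := leMv v; have := zAv v; have := wBv v.
have : minn (z v) (w v) = 0%N by have /mnmP/(_ v) := zw; rewrite mnmE mnm0E.
lia.
Qed.

(** * The substitution of -y for x *)

Definition subst x y p : R :=
  p \mPo [tuple if v == x then - 'X_y else 'X_v | v < n].

Lemma substXU x y v : subst x y 'X_v = if v == x then - 'X_y else 'X_v.
Proof. by rewrite /subst comp_mpolyXU -tnth_nth tnth_mktuple. Qed.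

Lemma substX x y m :
  x != y -> subst x y 'X_[m] = (-1) ^+ m x *: 'X_[merge x y m].
Proof.
move=> neq; rewrite /subst comp_mpolyX [in RHS]mpolyXE_id.
rewrite (bigD1 x) //= [in RHS](bigD1 x) //= tnth_mktuple eqxx mergeE eqxx mul1r.
rewrite (bigD1 y) 1?eq_sym //= [in RHS](bigD1 y) 1?eq_sym //= tnth_mktuple mergeE.
rewrite eqxx [y == x]eq_sym (negPf neq) mul1n exprD [(- 'X_y) ^+ _]exprNn.
rewrite -mul_mpolyC rmorph_sign.
rewrite -!mulrA; congr (_ * _); rewrite [RHS]mulrCA; congr (_ * (_ * _)).
apply: eq_bigr => v /andP [vx vy].
by rewrite tnth_mktuple mergeE (negPf vx) (negPf vy) addn0.
Qed.

Lemma subst_sum x y p :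
  subst x y p = \sum_(m <- msupp p) p@_m *: subst x y 'X_[m].
Proof. exact: comp_mpolyEX. Qed.

Lemma substM x y p q : subst x y (p * q) = subst x y p * subst x y q.
Proof. exact: rmorphM. Qed.

Lemma substD x y p q : subst x y (p + q) = subst x y p + subst x y q.
Proof. exact: rmorphD. Qed.

Lemma subst0 x y : subst x y 0 = 0.
Proof. exact: rmorph0. Qed.

Lemma subst_addX x y : x != y -> subst x y ('X_x + 'X_y) = 0.
Proof.
by move=> neq; rewrite substD !substXU eqxx [y == x]eq_sym (negPf neq) addNr.
Qed.

Lemma subst_supported x y p :
  x != y ->
  supported (fun m => exists2 m', m' \in msupp p & merge x y m' = m) (subst x y p).
Proof.
move=> neq; rewrite subst_sum big_seq.
apply: (big_ind (supported _)); [exact: supported0 | exact: supportedD |].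
move=> m pm m' /msuppZ_le; rewrite substX // => /msuppZ_le.
by rewrite msuppX inE => /eqP ->; exists m.
Qed.

Lemma subst_collapse x y S p :
  x != y -> supported S p -> supported (collapse x y S) (subst x y p).
Proof.
move=> neq Sp m /(subst_supported neq) [m' /Sp Sm' <-].
by exists m' => //; apply: lepm_refl.
Qed.

(** On a monomial u x^a the difference is u (x^a - (-y)^a), a multiple of x - (-y). *)
Lemma sub_subst_ideal (Q : R -> Prop) x y p :
  x != y -> ideal_gen Q ('X_x + 'X_y) -> ideal_gen Q (p - subst x y p).
Proof.
move=> neq Qxy; rewrite {1}[p]mpolyE subst_sum -sumrB.
apply: ideal_gen_sum => m _; rewrite -scalerBr -mul_mpolyC; apply: ideal_genM.
have [u [ux -> _]] := merge_split m neq.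
rewrite mpolyXD -mpolyXn substM /subst rmorphXn /= -!/(subst _ _ _) substXU eqxx.
rewrite substX // ux merge_id // scale1r -mulrBr subrXX opprK.
by apply: ideal_genM; rewrite mulrC; apply: ideal_genM.
Qed.

Lemma merge_ideal (Q : R -> Prop) x y m :
  x != y -> ideal_gen Q ('X_x + 'X_y) ->
  ideal_gen Q 'X_[m] -> ideal_gen Q 'X_[merge x y m].
Proof.
move=> neq Qxy Qm; have := sub_subst_ideal 'X_[m] neq Qxy.
move=> /(ideal_genM (-1)) /(ideal_genD Qm); rewrite mulN1r opprB addrC subrK.
(* The sign squares to one, so multiplying by it once more removes it. *)
rewrite substX // => /(ideal_genM ((-1) ^+ m x)%:MP).
by rewrite mul_mpolyC scalerA -expr2 sqrr_sign scale1r.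
Qed.

(** * Initial ideals after adjoining x + y *)

Lemma initial_ideal_supported mle J p :
  initial_ideal mle J p <->
  supported (fun m => exists2 m',
    exists2 f, J f & leading_monomial mle f m' & (m' <= m)%MM) p.
Proof. exact: ideal_gen_monomials. Qed.

Lemma leading_monomialX mle m :
  term_order mle -> leading_monomial mle ('X_[m] : R) m.
Proof.
case=> tot _ _ _ _; split; first by rewrite msuppX inE.
by move=> m'; rewrite msuppX inE => /eqP ->; have := tot m m; rewrite orbb.
Qed.

Lemma initial_ideal_monomial mle J S :
  term_order mle -> up_closed S -> (forall p, J p <-> supported S p) ->
  forall p, initial_ideal mle J p <-> supported S p.
Proof.
move=> ord upS JE p; rewrite initial_ideal_supported.
split; apply: supported_sub => m.
  by move=> [m' [f /JE Sf [fm' _]] le]; apply: up_closed_le le (Sf _ fm').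
move=> Sm; exists m; last exact: lepm_refl.
by exists 'X_[m]; [exact/JE/supportedX | exact: leading_monomialX].
Qed.

(** Trading the factors x for y one at a time never increases the monomial. *)
Lemma mle_merge (mle : rel 'X_{1..n}) x y m :
  term_order mle -> x != y -> mle U_(y)%MM U_(x)%MM -> mle (merge x y m) m.
Proof.
move=> [tot _ tr mleD _] neq yx.
have [u [_ eqm ->]] := merge_split m neq.
rewrite {2}eqm; elim: (m x) => [|a IHa].
  by rewrite !mulm0n; have := tot (u + 0)%MM (u + 0)%MM; rewrite orbb.
have le1 := mleD U_(y)%MM _ _ IHa.
have le2 := mleD (u + U_(x) *+ a)%MM _ _ yx.
by rewrite !mulmSr !addmA; apply: tr le2; rewrite ![(_ + U_(y))%MM]addmC.
Qed.

(** No cancellation can occur at m: a monomial m' of [f] that merges to m satisfies m <= m' by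
    [mle_merge] and m' <= m since m leads, so m' = m. *)
Lemma merge_leading mle x y f m :
  term_order mle -> x != y -> mle U_(y)%MM U_(x)%MM ->
  leading_monomial mle f m -> m x = 0%N -> m \in msupp (subst x y f).
Proof.
move=> ord neq yx [fm lead] mx; have [_ anti _ _ _] := ord.
rewrite mcoeff_msupp subst_sum raddf_sum /= (bigD1_seq m) ?msupp_uniq //=.
rewrite big1_seq ?addr0 => [|m' /andP [m'm fm']].
  rewrite substX // mcoeffZ merge_id // mx scale1r mcoeffX eqxx mulr1.
  by rewrite -mcoeff_msupp.
rewrite substX // !mcoeffZ mcoeffX; case: eqP => [e|_]; last by rewrite !mulr0.
case/negP: m'm; apply/eqP/anti; rewrite lead //= -e; exact: mle_merge.
Qed.

(** A leading monomial is either divisible by x or survives the substitution, which kills x + y and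
    sends [J] into the collapsed ideal. Conversely, x leads x + y, and merged monomials of [S] lie
    in (J, x + y). *)
Lemma initial_ideal_adjoin mle J S x y :
  term_order mle -> x != y -> mle U_(y)%MM U_(x)%MM ->
  (forall p, J p <-> supported S p) ->
  forall p, initial_ideal mle (adjoin J [:: 'X_x + 'X_y]) p <->
    supported (add_var x (collapse x y S)) p.
Proof.
move=> ord neq yx JE p; rewrite initial_ideal_supported.
have Jxy : adjoin J [:: 'X_x + 'X_y] ('X_x + 'X_y).
  by apply: ideal_gen_mem; right; rewrite inE.
split; apply: supported_sub => m.
  move=> [m' [f Jf lead] le]; apply: up_closed_le le _.
    exact/up_closed_add_var/up_closed_collapse.
  have [m'x|] := boolP (m' x == 0%N); last by rewrite -lep1mP; right.
  left; have := merge_leading ord neq yx lead (eqP m'x).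
  apply: (_ : supported _ _); move: f Jf {lead}; apply: ideal_gen_ind.
  - by rewrite subst0; apply: supported0.
  - by move=> f g Sf Sg; rewrite substD; apply: supportedD.
  move=> h g Jg; rewrite substM; apply: supportedM.
    exact: up_closed_collapse.
  case: Jg => [/JE|]; first exact: subst_collapse.
  by rewrite inE => /eqP ->; rewrite subst_addX //; apply: supported0.
case=> [[N SN le]|le]; last first.
  exists U_(x)%MM => //; exists ('X_x + 'X_y) => //; split.
    rewrite mcoeff_msupp mcoeffD !mcoeffXU eqxx [y == x]eq_sym (negPf neq) addr0.
    exact: oner_neq0.
  move=> m' /msuppD_le; rewrite mem_cat !msuppX !inE => /orP [] /eqP -> //.
  by case: ord => tot _ _ _ _; have := tot U_(x)%MM U_(x)%MM; rewrite orbb.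
exists (merge x y N) => //; exists 'X_[merge x y N]; last exact: leading_monomialX.
by apply: merge_ideal => //; apply: ideal_gen_mem; left; apply/JE/supportedX.
Qed.

(** * Iteration over a list of disjoint pairs *)

Implicit Types (ps : seq ('I_n * 'I_n)) (q : 'I_n * 'I_n).

Definition forms ps : seq R := [seq 'X_(q.1) + 'X_(q.2) | q <- ps].

Lemma nth_forms q0 ps k :
  (k < size ps)%N ->
  (forms ps)`_k = 'X_((nth q0 ps k).1) + 'X_((nth q0 ps k).2).
Proof. by move=> ltk; rewrite /forms (nth_map q0). Qed.

Definition collapse_all S ps := foldl (fun S q => collapse q.1 q.2 S) S ps.

Definition initial_all S ps :=
  foldl (fun S q => add_var q.1 (collapse q.1 q.2 S)) S ps.

Definition subst_all ps p := foldl (fun p q => subst q.1 q.2 p) p ps.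

Definition disjoint_from q q' : bool :=
  [&& q.1 != q'.1, q.1 != q'.2, q.2 != q'.1 & q.2 != q'.2].

Lemma up_closed_collapse_all S ps : up_closed S -> up_closed (collapse_all S ps).
Proof.
by elim: ps S => //= q ps IHps S upS; apply/IHps/up_closed_collapse.
Qed.

Lemma up_closed_initial_all S ps : up_closed S -> up_closed (initial_all S ps).
Proof.
elim: ps S => //= q ps IHps S upS.
exact/IHps/up_closed_add_var/up_closed_collapse.
Qed.

Lemma lcm_witness_collapse_all S ps q M :
  all (disjoint_from^~ q) ps -> (forall q', q' \in ps -> M q'.1 = 0%N /\ M q'.2 = 0%N) ->
  up_closed S -> lcm_witness S q.1 q.2 M ->
  lcm_witness (collapse_all S ps) q.1 q.2 M.
Proof.
elim: ps S => //= q' ps IHps S /andP [/and4P [n1 n2 n3 n4] djps] Mps upS witS.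
have [M1 M2] := Mps q' (mem_head _ _).
apply: IHps => //; last exact: lcm_witness_collapse.
  by move=> q'' in_ps; apply: Mps; rewrite inE in_ps orbT.
exact: up_closed_collapse.
Qed.

Lemma lcm_witness_initial_all S ps q M :
  all (disjoint_from^~ q) ps -> (forall q', q' \in ps -> M q'.1 = 0%N /\ M q'.2 = 0%N) ->
  up_closed S -> lcm_witness S q.1 q.2 M ->
  lcm_witness (initial_all S ps) q.1 q.2 M.
Proof.
elim: ps S => //= q' ps IHps S /andP [/and4P [n1 n2 n3 n4] djps] Mps upS witS.
have [M1 M2] := Mps q' (mem_head _ _).
apply: IHps => //; last exact/lcm_witness_add_var/lcm_witness_collapse.
  by move=> q'' in_ps; apply: Mps; rewrite inE in_ps orbT.
exact/up_closed_add_var/up_closed_collapse.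
Qed.

Lemma subst_all0 ps : subst_all ps 0 = 0.
Proof. by elim: ps => //= q ps IHps; rewrite subst0. Qed.

Lemma subst_allD ps p p' : subst_all ps (p + p') = subst_all ps p + subst_all ps p'.
Proof. by elim: ps p p' => //= q ps IHps p p'; rewrite substD IHps. Qed.

Lemma subst_allM ps p p' : subst_all ps (p * p') = subst_all ps p * subst_all ps p'.
Proof. by elim: ps p p' => //= q ps IHps p p'; rewrite substM IHps. Qed.

Lemma subst_disjoint q q' :
  disjoint_from q q' ->
  subst q.1 q.2 ('X_(q'.1) + 'X_(q'.2)) = 'X_(q'.1) + 'X_(q'.2).
Proof.
move=> /and4P [n1 n2 _ _].
by rewrite substD !substXU ![_ == q.1]eq_sym (negPf n1) (negPf n2).
Qed.

Lemma subst_all_disjoint ps q :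
  all (disjoint_from^~ q) ps ->
  subst_all ps ('X_(q.1) + 'X_(q.2)) = 'X_(q.1) + 'X_(q.2).
Proof.
elim: ps => //= q' ps IHps /andP [dj djps].
by rewrite subst_disjoint // IHps.
Qed.

(** Earlier substitutions fix the form by disjointness, its own kills it, and later ones act on
    zero. *)
Lemma subst_all_form ps f :
  all (fun q => q.1 != q.2) ps -> pairwise disjoint_from ps ->
  f \in forms ps -> subst_all ps f = 0.
Proof.
elim: ps => //= q ps IHps /andP [neq neqps] /andP [djq djps].
rewrite inE => /orP [/eqP ->|fps]; first by rewrite subst_addX // subst_all0.
have /mapP [q' q'ps ef] := fps; rewrite [in subst _ _ _]ef subst_disjoint; last first.
  by have /allP := djq; apply.
by rewrite -ef IHps.
Qed.

Lemma subst_all_collapse S ps p :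
  all (fun q => q.1 != q.2) ps -> supported S p ->
  supported (collapse_all S ps) (subst_all ps p).
Proof.
elim: ps S p => //= q ps IHps S p /andP [neq neqps] Sp.
by apply: IHps => //; apply: subst_collapse.
Qed.

Lemma sub_subst_all ps (Q : R -> Prop) p :
  all (fun q => q.1 != q.2) ps ->
  (forall f, f \in forms ps -> ideal_gen Q f) -> ideal_gen Q (p - subst_all ps p).
Proof.
elim: ps p => [|q ps IHps] p /=; first by rewrite subrr => _ _; apply: ideal_gen0.
move=> /andP [neq neqps] Qps.
rewrite -(subrKA (subst q.1 q.2 p)); apply: ideal_genD.
  by apply: sub_subst_ideal => //; apply: Qps; rewrite mem_head.
by apply: IHps => // f fps; apply: Qps; rewrite inE fps orbT.
Qed.

Lemma collapse_all_adjoin J S ps m :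
  all (fun q => q.1 != q.2) ps -> (forall m, S m -> J 'X_[m]) ->
  collapse_all S ps m -> adjoin J (forms ps) 'X_[m].
Proof.
(* Induction from the end of the list, since the last pair gives the outermost collapse. *)
move=> neqps SJ; elim/last_ind: ps m neqps => [|ps q IHps] m.
  by move=> _ /SJ Jm; apply: ideal_gen_mem; left.
rewrite all_rcons /collapse_all foldl_rcons => /andP [neq neqps] [N SN le].
rewrite -(submK le) mpolyXD; apply: ideal_genM; apply: merge_ideal => //.
  apply: ideal_gen_mem; right; apply: map_f.
  by rewrite mem_rcons mem_head.
apply: (adjoin_sub _ (IHps _ neqps SN)) => f /mapP [q' q'ps ->].
by apply: map_f; rewrite mem_rcons inE q'ps orbT.
Qed.

(** Membership becomes a question about a monomial ideal: the substitutions form a ring morphism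
    killing the forms, and a polynomial is congruent to its image modulo the forms. *)
Lemma adjoin_forms J S ps p :
  all (fun q => q.1 != q.2) ps -> pairwise disjoint_from ps ->
  up_closed S -> (forall p, J p <-> supported S p) ->
  adjoin J (forms ps) p <-> supported (collapse_all S ps) (subst_all ps p).
Proof.
move=> neqps djps upS JE; split.
  move: p; apply: ideal_gen_ind.
  - by rewrite subst_all0; apply: supported0.
  - by move=> p p' Sp Sp'; rewrite subst_allD; apply: supportedD.
  move=> h g Jg; rewrite subst_allM; apply: supportedM.
    exact: up_closed_collapse_all.
  case: Jg => [/JE|]; first exact: subst_all_collapse.
  by move/(subst_all_form neqps djps) ->; apply: supported0.
move=> Sp; rewrite -(subrK (subst_all ps p) p); apply: ideal_genD.
  by apply: sub_subst_all => // f fps; apply: ideal_gen_mem; right.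
rewrite [subst_all ps p]mpolyE; apply: ideal_gen_sum => m /Sp Sm.
rewrite -mul_mpolyC; apply: ideal_genM; apply: collapse_all_adjoin Sm => //.
by move=> m' Sm'; apply/JE/supportedX.
Qed.

Lemma initial_chain_forms mle J S ps k :
  term_order mle ->
  (forall q, q \in ps -> q.1 != q.2 /\ mle U_(q.2)%MM U_(q.1)%MM) ->
  up_closed S -> (forall p, J p <-> supported S p) -> (k <= size ps)%N ->
  forall p, initial_chain mle J (forms ps) k p <->
    supported (initial_all S (take k ps)) p.
Proof.
move=> ord ps_ord upS JE; elim: k => [|k IHk] le_k.
  by rewrite take0; apply: initial_ideal_monomial.
(* Any pair of the nonempty list serves as the default value of [nth]. *)
have [q0 _] : exists q, q \in ps.
  by case: (ps) le_k => // q ? _; exists q; rewrite mem_head.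
rewrite (take_nth q0) // /initial_all foldl_rcons /= (nth_forms q0) //.
have [neq le] := ps_ord _ (mem_nth q0 le_k).
by apply: initial_ideal_adjoin => //; apply/IHk/ltnW.
Qed.

Lemma max_ideal_addX x y : max_ideal ('X_x + 'X_y : R).
Proof. by apply: ideal_genD; apply: ideal_gen_mem; [exists x | exists y]. Qed.

Lemma addX_nonconstant x y (c : K) : x != y -> 'X_x + 'X_y != c%:MP :> R.
Proof.
move=> neq; apply/eqP => /(congr1 (mcoeff U_(x))) /eqP.
rewrite mcoeffD !mcoeffXU mcoeffC eqxx [y == x]eq_sym (negPf neq) addr0.
by rewrite mnm1_eq0 mulr0 oner_eq0.
Qed.

End MonomialIdeals.

(** * Regularity and initial regularity of the sums of leaf pairs *)

Theorem theorem4p9 (K : fieldType) (n : nat) (I : {mpoly K[n]} -> Prop)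
    (hI : monomial_ideal I) (l : nat) (x y : 'I_l -> 'I_n)
    (hpair : forall i, leaf_pair I (x i) (y i))
    (hdisj : forall i j, i != j -> disjoint_pairs (x i) (y i) (x j) (y j)) :
  let fs : seq {mpoly K[n]} := [seq 'X_(x i) + 'X_(y i) | i <- enum 'I_l] in
  regular_sequence I fs /\
  forall mle : rel 'X_{1..n}, term_order mle ->
    (forall i, mlt mle U_(y i)%MM U_(x i)%MM) ->
    initially_regular_sequence mle I fs.
Proof.
move=> fs; set ps := [seq (x i, y i) | i <- enum 'I_l].
have fsE : fs = forms K ps by rewrite /forms -map_comp.
have [upI IE] := monomial_ideal_supported hI.
have neqps : all (fun q => q.1 != q.2) ps.
  by apply/allP => _ /mapP [i _ ->] /=; case: (hpair i) => /eqP.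
have djps : pairwise (@disjoint_from n) ps.
  rewrite pairwise_map; have := enum_uniq 'I_l; rewrite uniq_pairwise.
  apply: sub_pairwise => i j /= /hdisj /setP dj.
  (* Testing the empty intersection at x i and y i yields the four inequalities. *)
  have [dx dy] := (dj (x i), dj (y i)); move: dx dy.
  rewrite !inE !eqxx orbT /= => /negbT; rewrite negb_or => /andP [n1 n2].
  by move=> /negbT; rewrite negb_or => /andP [n3 n4]; apply/and4P.
have size_fs : size fs = size ps by rewrite fsE size_map.
have nth_fs k : (k < size ps)%N -> exists q, [/\ q \in ps, q.1 != q.2,
    all (@disjoint_from n ^~ q) (take k ps), fs`_k = 'X_(q.1) + 'X_(q.2)
  & exists M, lcm_witness (monomials_in I) q.1 q.2 M /\
      forall q', q' \in take k ps -> M q'.1 = 0%N /\ M q'.2 = 0%N].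
  move=> ltk; have [q0 _] : exists q, q \in ps.
    by case: (ps) ltk => // q ? _; exists q; rewrite mem_head.
  have in_ps := mem_nth q0 ltk; exists (nth q0 ps k).
  have /mapP [i _ ei] := in_ps.
  split=> //.
  - exact: (allP neqps).
  - move: djps; rewrite -{1}(cat_take_drop k ps) (drop_nth q0) // pairwise_cat.
    move=> /and3P [/allrelP dj _ _]; apply/allP => q' q'ps.
    by apply: dj => //; rewrite mem_head.
  - by rewrite fsE (nth_forms _ q0).
  (* [M] involves no leaf, hence no variable of the earlier pairs. *)
  have [M witM Mleaf] := leaf_pair_witness hI (hpair i); exists M.
  rewrite ei; split=> // q' /mem_take /mapP [j _ ->] /=.
  by case: (hpair j) => _ lx ly _; split; apply: Mleaf.
split.
  move=> k; rewrite size_fs => ltk.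
  have [q [_ neq dj -> [M [witM M0]]]] := nth_fs k ltk.
  split; first exact: max_ideal_addX.
  have fs_take : take k fs = forms K (take k ps) by rewrite fsE /forms map_take.
  have neqt : all (fun q => q.1 != q.2) (take k ps).
    by apply/allP => q' /mem_take; apply: (allP neqps).
  have djt := subseq_pairwise (take_subseq ps k) djps.
  (* After the earlier substitutions, which fix the current form, the claim is cancellation of x + y
     modulo the collapsed monomial ideal. *)
  move=> p; rewrite fs_take !(adjoin_forms _ neqt djt upI IE) subst_allM.
  rewrite subst_all_disjoint //; apply: addX_cancel => //.
    exact: up_closed_collapse_all.
  apply: lcm_witness_cancel (lcm_witness_collapse_all dj M0 upI witM).
  exact: up_closed_collapse_all.
move=> mle ord lt_yx k; rewrite size_fs => ltk.
have [q [_ neq dj -> [M [witM M0]]]] := nth_fs k ltk.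
split=> [c|]; first exact: addX_nonconstant.
split; first exact: max_ideal_addX.
have ps_ord q' : q' \in ps -> q'.1 != q'.2 /\ mle U_(q'.2)%MM U_(q'.1)%MM.
  move=> in_ps; split; first exact: (allP neqps).
  by have /mapP [i _ ->] := in_ps; case/andP: (lt_yx i).
(* Here the ideal of the chain is itself monomial, so cancellation applies without any
   substitution. *)
move=> p; rewrite fsE !(initial_chain_forms ord ps_ord upI IE (ltnW ltk)).
apply: addX_cancel => //; first exact: up_closed_initial_all.
apply: lcm_witness_cancel (lcm_witness_initial_all dj M0 upI witM).
exact: up_closed_initial_all.
Qed.
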